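(* Let $F$ be a countable ELA-field and let $F\subseteq F|V$ be the extension of ELA-fields determined by an irreducible subvariety $V\subseteq(\mathbb{G}_{\mathrm a}\times\mathbb{G}_{\mathrm m})^n$ over $F$ which is additively free, multiplicatively free, and Kummer-generic. Then the extension $F\subseteq F|V$ is strong if and only if $V$ is rotund.
   Context: A partial E-field $F$ is a field of characteristic zero together with a $\mathbb{Q}$-linear subspace $D(F)$ of its additive group and a homomorphism $\exp_F$ (also $x\mapsto e^x$) from $(D(F),+)$ to the multiplicative group of $F$. Extensions are inclusions respecting domains and exponential maps, assumed kernel-preserving (same $\{x\in D:\exp(x)=1\}$). An ELA-field is a partial E-field with $D(F)=F$ that is algebraically closed and in which every nonzero element is some $\exp(a)$. For a subset $X$ of an ELA-field $L$, $\langle X\rangle_L^{ELA}$ is the smallest ELA-subfield containing $X$. For a finite tuple $\bar x$ from $D(F)$ and $B\subseteq D(F)$, $\delta(\bar x/B)=\mathrm{td}(\bar x,\exp(\bar x)/B,\exp(B))-\mathrm{ldim}_{\mathbb{Q}}(\bar x/B)$ (transcendence degree over $\mathbb{Q}(B,\exp B)$ minus $\mathbb{Q}$-linear dimension modulo $\mathrm{span}_{\mathbb{Q}}B$). $F\subseteq F_1$ is strong, $F\lhd F_1$, if $\delta(\bar x/D(F))\ge0$ for all finite tuples $\bar x$ from $D(F_1)$. If $K$ is a finitely generated partial E-field extension of a countable ELA-field, $K^{ELA}$ denotes the (unique up to isomorphism over $K$) kernel-preserving strong extension $K\lhd L$ with $L$ an ELA-field and $L=\langle K\rangle_L^{ELA}$.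 Let $G=\mathbb{G}_{\mathrm a}\times\mathbb{G}_{\mathrm m}$, $F$ an ELA-field, $V\subseteq G^n$ an irreducible subvariety over $F$ with prime ideal $I(V)\subseteq F[\bar X,\bar Y,\bar Y^{-1}]$. $V$ is additively free if $I(V)$ contains no $\sum r_iX_i-c$ with $r_i\in\mathbb{Z}$ not all zero, $c\in F$; multiplicatively free if $I(V)$ contains no $\prod Y_i^{r_i}-d$ with $r_i\in\mathbb{Z}$ not all zero, $d\in F^\times$. Let $R=F[X_1,\ldots,X_n,(Y_{m,i})_{m\in\mathbb{Z}\setminus\{0\},1\le i\le n}]$, with coherence polynomials $Y_{mr,i}^r-Y_{m,i}$ ($m\ne0$, $r\ge1$) and $Y_{m,i}Y_{-m,i}-1$. For a prime ideal $I$ of $R$ containing these, $I_1$ is the ideal of those $f\in F[\bar X,\bar Y,\bar Y^{-1}]$ lying in $I$ after substituting $Y_i=Y_{1,i}$, $Y_i^{-1}=Y_{-1,i}$. An additively free $V$ is Kummer-generic if there is only one additively free prime ideal $I$ of $R$ containing the coherence polynomials with $I_1=I(V)$. For $V$ additively free, multiplicatively free and Kummer-generic there is a unique (up to isomorphism over $F$) partial E-field extension $K$ of $F$ generated by a tuple $\bar a$ from $D(K)$ with $(\bar a,e^{\bar a})$ generic in $V$ over $F$ (the fraction field of $R/I$, with $D(K)=F+\mathrm{span}_{\mathbb{Q}}(\bar a)$, $a_i$ the image of $X_i$, $\exp(a_i/m)$ the image of $Y_{m,i}$); $F|V$ denotes $K^{ELA}$. A matrix $M\in\mathrm{Mat}_{n\times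 n}(\mathbb{Z})$ acts on $G^n$ linearly on additive and multiplicatively on multiplicative coordinates; $M\cdot V$ is the image of $V$. An irreducible $V\subseteq G^n$ is rotund if $\dim M\cdot V\ge\mathrm{rk}\,M$ for every $M\in\mathrm{Mat}_{n\times n}(\mathbb{Z})$. *)

(* Defs.v *)
From HB Require Import structures.
From mathcomp Require Import all_boot all_order all_algebra.
From mathcomp Require Import boolp classical_sets cardinality.
(* [monalg] supplies polynomial rings in infinitely many variables,
   [malg (cmonom I) F] = F[x_i, i in I]; its notations clash with [mpoly]. *)
From mathcomp Require Import -(notations) monalg.
From mathcomp Require Import mpoly.

Set Implicit Arguments.
Unset Strict Implicit.
Unset Printing Implicit Defensive.

Import Order.TTheory GRing.Theory Num.Theory.
Local Open Scope classical_set_scope.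
Local Open Scope ring_scope.

(* The greatest natural number satisfying [P]; the value is 0 if there is none.
   Below it is only used for sets of ranks, which contain 0 and are bounded. *)
Definition max_nat (P : set nat) : nat :=
  xget 0%N [set m | P m /\ forall k, P k -> (k <= m)%N].

Section Fields.
Variable K : fieldType.

Definition subfield (S : set K) : Prop := GRing.divring_closed (mem S).

Definition subfield_gen (X : set K) : set K := smallest subfield X.

Definition alg_indep (k : set K) (m : nat) (z : 'I_m -> K) : Prop :=
  forall p : {mpoly K[m]}, (forall mu, k p@_mu) -> p.@[z] = 0 -> p = 0.

(* Transcendence degree of the field extension k <= E. *)
Definition trdeg (k E : set K) : nat :=
  max_nat [set m | exists z : 'I_m -> K, (forall i, E (z i)) /\ alg_indep k z].

(* Q-linear subspaces of (K, +), for K of characteristic 0. *)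
Definition Qsubspace (S : set K) : Prop :=
  [/\ S 0, forall x y, S x -> S y -> S (x + y)
         & forall (q : rat) x, S x -> S (ratr q * x)].

Definition Qspan (X : set K) : set K := smallest Qsubspace X.

(* Q-dimension of span(X) modulo span(B), that is of (span(X)+span(B))/span(B). *)
Definition ldim (X B : set K) : nat :=
  max_nat [set m | exists y : 'I_m -> K, (forall i, Qspan (X `|` B) (y i)) /\
    forall q : 'I_m -> rat,
      Qspan B (\sum_i ratr (q i) * y i) -> forall i, q i = 0].

End Fields.

(* Partial E-fields.  [pexp] is total as a Rocq function, but its values outside
   [dom] are junk and never used. *)
Record pefield := PEField {
  pe_sort :> fieldType;
  pe_char0 : [pchar pe_sort] =i pred0;
  dom : set pe_sort;
  pexp : pe_sort -> pe_sort;
  dom_Qsubspace : Qsubspace dom;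
  pexp_neq0 : forall x, dom x -> pexp x != 0;
  pexpD : forall x y, dom x -> dom y -> pexp (x + y) = pexp x * pexp y
}.

Arguments dom : clear implicits.

Definition ELA_field (F : pefield) : Prop :=
  [/\ dom F = [set: F], GRing.closed_field_axiom F
    & forall y : F, y != 0 -> exists x : F, pexp x = y].

(* The third clause is [GRing.closed_field_axiom] for S.  The last one says that
   the inclusion of S in L is kernel-preserving, as all extensions are. *)
Definition ELA_subfield (L : pefield) (S : set L) : Prop :=
  [/\ subfield S,
      forall x, S x -> S (pexp x),
      forall (m : nat) (P : nat -> L), (0 < m)%N -> (forall i, S (P i)) ->
        exists2 x, S x & x ^+ m = \sum_(i < m) P i * x ^+ i,
      forall y, S y -> y != 0 -> exists2 x, S x & pexp x = y
    & forall x : L, pexp x = 1 -> S x].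

Definition ELA_gen (L : pefield) (X : set L) : set L :=
  smallest (@ELA_subfield L) X.

(* Kernel-preserving extensions of partial E-fields, as embeddings. *)
Definition extension (F K : pefield) (f : {rmorphism F -> K}) : Prop :=
  [/\ forall x, dom F x -> dom K (f x),
      forall x, dom F x -> pexp (f x) = f (pexp x)
    & forall y : K, dom K y -> pexp y = 1 ->
        exists x : F, [/\ dom F x, pexp x = 1 & f x = y]].

(* delta(x / B) = td(x, exp x / B, exp B) - ldim_Q(x / B). *)
Definition delta (L : pefield) (m : nat) (x : 'I_m -> L) (B : set L) : int :=
  let base := B `|` (@pexp L @` B) in
  let pts := range x `|` (@pexp L @` range x) in
  (trdeg (subfield_gen base) (subfield_gen (base `|` pts)))%:Z
  - (ldim (range x) B)%:Z.

Definition strong (F K : pefield) (f : F -> K) : Prop :=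
  forall (m : nat) (x : 'I_m -> K), (forall i, dom K (x i)) ->
    0 <= delta x (f @` dom F).

(* K^ELA: [j] presents L as a strong kernel-preserving ELA-extension of K
   which is generated by K as an ELA-field. *)
Definition ELA_closure (K L : pefield) (j : {rmorphism K -> L}) : Prop :=
  [/\ ELA_field L, extension j, strong j & ELA_gen (range j) = [set: L]].

Section Varieties.
Variables (F : fieldType) (n : nat).

(* Ambient type for the F-points (x, y) of (Ga x Gm)^n; see [inG]. *)
Definition gpoint (K : fieldType) : Type := (('I_n -> K) * ('I_n -> K))%type.

Definition inG (v : gpoint F) : Prop := forall i, v.2 i != 0.

(* A Laurent polynomial in F[X, Y, Y^-1] is represented by a polynomial in the
   3n variables X, Y, Z, where Z_i stands for Y_i^-1.  So F[X, Y, Y^-1] is the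
   quotient of this ring by the Y_i Z_i - 1, and its ideals are represented by
   the ideals containing all Y_i Z_i - 1, as all those used below do. *)
Definition laurent : Type := {mpoly F[n + n + n]}.

Definition lX (i : 'I_n) : laurent := 'X_(lshift n (lshift n i)).
Definition lY (i : 'I_n) : laurent := 'X_(lshift n (rshift n i)).
Definition lZ (i : 'I_n) : laurent := 'X_(rshift (n + n) i).

Definition lvals (T : Type) (x y z : 'I_n -> T) (k : 'I_(n + n + n)) : T :=
  match split k with
  | inl l => match split l with inl i => x i | inr i => y i end
  | inr i => z i
  end.

(* Value at a point of G^n(K), with coefficients mapped to K by [f]. *)
Definition leval (K : fieldType) (f : F -> K) (v : gpoint K) (p : laurent) : K :=
  mmap f (lvals v.1 v.2 (fun i => (v.2 i)^-1)) p.

(* F is algebraically closed in all uses, so that subvarieties over F are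
   identified with their sets of F-points. *)
Definition subvariety (V : set (gpoint F)) : Prop :=
  exists S : set laurent,
    V = [set v | inG v /\ forall p, S p -> leval idfun v p = 0].

Definition irreducible (V : set (gpoint F)) : Prop :=
  V !=set0 /\ forall A B, subvariety A -> subvariety B ->
    V `<=` A `|` B -> V `<=` A \/ V `<=` B.

(* I(V) *)
Definition videal (V : set (gpoint F)) : set laurent :=
  [set p | forall v, V v -> leval idfun v p = 0].

(* Y_i ^ r for an integer r *)
Definition lYexp (i : 'I_n) (r : int) : laurent :=
  match r with Posz k => lY i ^+ k | Negz k => lZ i ^+ k.+1 end.

Definition additively_free (V : set (gpoint F)) : Prop :=
  forall (r : 'I_n -> int) (c : F), (exists i, r i != 0) ->
    ~ videal V (\sum_i lX i *~ r i - c%:MP).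

Definition multiplicatively_free (V : set (gpoint F)) : Prop :=
  forall (r : 'I_n -> int) (d : F), (exists i, r i != 0) -> d != 0 ->
    ~ videal V (\prod_i lYexp i (r i) - d%:MP).

(* The ring R = F[X_i, Y_{m,i} : m in Z \ {0}, i], as the polynomial ring on the
   index type [kvar]. *)
Definition nzint : choiceType := {m : int | m != 0}.
Definition kvar : choiceType := ('I_n + nzint * 'I_n)%type.
Definition kring : comNzRingType := malg (cmonom kvar) F.

Definition kconst (c : F) : kring := c *: (1 : malg (cmonom kvar) F).
Definition kX (i : 'I_n) : kring := mkmalgU (ucm (inl i : kvar)) 1.
Definition kY (m : nzint) (i : 'I_n) : kring :=
  mkmalgU (ucm (inr (m, i) : kvar)) 1.

Definition nz1 : nzint := exist (fun m : int => m != 0) 1 isT.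
Definition nzN1 : nzint := exist (fun m : int => m != 0) (-1) isT.

(* The substitution Y_i := Y_{1,i}, Y_i^-1 := Y_{-1,i}. *)
Definition ksubst (p : laurent) : kring :=
  mmap kconst (lvals kX (kY nz1) (kY nzN1)) p.

Definition coherent (I : set kring) : Prop :=
  (forall (m m' : nzint) (r : nat) (i : 'I_n), (1 <= r)%N ->
     val m' = val m * r%:Z -> I (kY m' i ^+ r - kY m i)) /\
  (forall (m m' : nzint) (i : 'I_n),
     val m' = - val m -> I (kY m i * kY m' i - 1)).

Definition kadditively_free (I : set kring) : Prop :=
  forall (r : 'I_n -> int) (c : F), (exists i, r i != 0) ->
    ~ I (\sum_i kX i *~ r i - kconst c).

Definition kummer_generic (V : set (gpoint F)) : Prop :=
  exists! I : set kring,
    [/\ idealr_closed (mem I), prime_idealr_closed (mem I),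
        coherent I, kadditively_free I
      & [set p | I (ksubst p)] = videal V].

(* Dimension of an irreducible set S of points (not necessarily closed): the
   transcendence degree over F of its coordinate ring F[X, Y, Y^-1] / I(S),
   i.e. the greatest number of regular functions which are algebraically
   independent on S.  This is the dimension of the Zariski closure of S. *)
Definition vdim (S : set (gpoint F)) : nat :=
  max_nat [set d | exists f : 'I_d -> laurent, forall p : {mpoly F[d]},
    (forall v, S v -> p.@[fun i => leval idfun v (f i)] = 0) -> p = 0].

Definition mat_act (M : 'M[int]_n) (v : gpoint F) : gpoint F :=
  (fun i => \sum_j v.1 j *~ M i j, fun i => \prod_j v.2 j ^ M i j).

Definition rotund (V : set (gpoint F)) : Prop :=
  forall M : 'M[int]_n,
    (\rank (map_mx intr M : 'M[rat]_n) <= vdim (mat_act M @` V))%N.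

End Varieties.

(* K is a partial E-field extension of F generated by a tuple [a] from D(K),
   with (a, exp a) generic in V over F: D(K) is spanned by D(F) and a, the field
   K is generated by F, D(K) and exp(D(K)), and the Laurent polynomials over F
   vanishing at (a, exp a) are exactly those in I(V). *)
Definition generic_extension (F : pefield) (n : nat) (V : set (gpoint n F))
    (K : pefield) (i : {rmorphism F -> K}) (a : 'I_n -> K) : Prop :=
  [/\ extension i,
      dom K = Qspan ((i @` dom F) `|` range a),
      subfield_gen (range i `|` dom K `|` (@pexp K @` dom K)) = [set: K]
    & forall p : laurent F n,
        leval i (a, fun k => pexp (a k)) p = 0 <-> videal V p].

(* [f : F -> L] is (a copy of) the extension F <= F|V. *)
Definition free_extension (F : pefield) (n : nat) (V : set (gpoint n F))
    (L : pefield) (f : {rmorphism F -> L}) : Prop :=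
  exists (K : pefield) (i : {rmorphism F -> K}) (a : 'I_n -> K)
         (j : {rmorphism K -> L}),
    [/\ generic_extension V i a, ELA_closure j & f =1 j \o i].

(* Main.v *)
(* Write rk_a for the rank function of algebraic closure and rk_l for that of
   rational span; both closures have the exchange property, and td and ldim are
   their ranks.  Put D = F + span_Q(a).  Since D is strong in F|V, everything
   happens between F and D.
   A tuple M.a, with M an integer matrix, has rk_l(M.a / F) = rk M because a is
   linearly independent over F (V is additively free), and
   rk_a(M.a, exp(M.a) / F) = dim M.V because (a, exp a) is generic in V.  So
   delta(M.a / F) = dim M.V - rk M, and strongness implies rotundity.
   Conversely, for a tuple x let y be a basis over F of (F + span x) /\ D.  Then
   rk_l(x / F) = |y| + rk_l(x / D) by modularity, and
   rk_a(x, exp x / F) >= rk_a(y, exp y / F) + rk_a(x, exp x / D, exp D), so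
   delta(x / F) >= delta(y / F) + delta(x / D); clearing denominators turns y
   into some M.a, up to translation by F and division by an integer. *)

Require Import Defs.
From HB Require Import structures.
From mathcomp Require Import all_boot all_order all_algebra.
From mathcomp Require Import boolp classical_sets cardinality.
From mathcomp Require Import perm mpoly.

Set Implicit Arguments.
Unset Strict Implicit.
Unset Printing Implicit Defensive.

Import Order.TTheory GRing.Theory Num.Theory.
Local Open Scope classical_set_scope.
Local Open Scope ring_scope.

(** * Maxima of sets of naturals, and lists viewed as sets *)

Lemma max_natE (P : set nat) r :
  P r -> (forall k, P k -> (k <= r)%N) -> max_nat P = r.
Proof.
move=> Pr ler; apply: (@xget_unique _ _ _ r) => // k [Pk lek].
by apply/eqP; rewrite eqn_leq ler // lek.
Qed.

Lemma set_seq_cons (T : choiceType) (x : T) s :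
  [set` x :: s] = [set x] `|` [set` s].
Proof.
apply/seteqP; split=> y; rewrite /= inE.
  by case/orP=> [/eqP|]; [left|right].
by case=> [->|->]; rewrite ?eqxx ?orbT.
Qed.

Lemma set_codom (T : choiceType) n (z : 'I_n -> T) : [set` codom z] = range z.
Proof.
apply/seteqP; split=> y /=; first by move=> /codomP[i ->]; exists i.
by case=> i _ <-; apply: codom_f.
Qed.

Lemma codom_ordSr (T : choiceType) n (z : 'I_n.+1 -> T) :
  codom z = rcons (codom (z \o widen_ord (leqnSn n))) (z ord_max).
Proof. by rewrite /codom /image_mem enum_ordSr map_rcons -map_comp. Qed.

Lemma codom_tnth (T : choiceType) n (t : n.-tuple T) : codom (tnth t) = t.
Proof. by rewrite /codom /image_mem map_tnth_enum. Qed.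

(** * Closure operators with the exchange property *)

Section Rank.
Variables (T : choiceType) (cl : set T -> set T).

Definition exchange_closure : Prop :=
  [/\ forall B, B `<=` cl B,
      forall B C, B `<=` cl C -> cl B `<=` cl C
    & forall B x y, cl (B `|` [set x]) y -> ~ cl B y -> cl (B `|` [set y]) x].

(* The size of the basis of [s] over [B] found by the greedy algorithm. *)
Fixpoint rk (B : set T) (s : seq T) : nat :=
  if s is x :: s' then (~~ `[< cl B x >] + rk (B `|` [set x]) s')%N else 0%N.

Fixpoint indep (B : set T) (s : seq T) : Prop :=
  if s is x :: s' then ~ cl B x /\ indep (B `|` [set x]) s' else True.

Hypothesis clP : exchange_closure.

Let cl_sub B : B `<=` cl B. Proof. by case: clP. Qed.
Let cl_trans B C : B `<=` cl C -> cl B `<=` cl C.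
Proof. by case: clP => _ + _; apply. Qed.
Let cl_exch B x y :
  cl (B `|` [set x]) y -> ~ cl B y -> cl (B `|` [set y]) x.
Proof. by case: clP => _ _; apply. Qed.

Lemma cl_mono B C : B `<=` C -> cl B `<=` cl C.
Proof. by move=> BC; apply: cl_trans; apply: subset_trans BC _. Qed.

Lemma rk_cat B s t : rk B (s ++ t) = (rk B s + rk (B `|` [set` s]) t)%N.
Proof.
elim: s B => [|x s IH] B /=; first by rewrite set_nil setU0.
by rewrite IH set_seq_cons setUA addnA.
Qed.

Lemma indep_cat B s t :
  indep B (s ++ t) <-> indep B s /\ indep (B `|` [set` s]) t.
Proof.
elim: s B => [|x s IH] B /=; first by rewrite set_nil setU0; split=> // -[].
by rewrite IH set_seq_cons setUA; split=> [[? []]|[[]]].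
Qed.

(** Over a larger base more of the greedy membership tests succeed, so fewer elements are
    counted. *)
Lemma rk_anti B C s : B `<=` cl C -> (rk C s <= rk B s)%N.
Proof.
elim: s B C => //= x s IH B C BC; apply: leq_add.
  case: (asboolP (cl C x)) => // nCx; case: (asboolP (cl B x)) => // Bx.
  by case: nCx; apply: cl_trans Bx.
apply: IH => y [/BC Cy|->]; first by apply: cl_mono Cy => z; left.
by apply: cl_sub; right.
Qed.

(** The head x of s is exchanged for the first y in t whose addition brings x into the closure. The
    rest of s is independent over B and x, and there t without y still generates it. *)
Lemma steinitz B s t :
  indep B s -> [set` s] `<=` cl (B `|` [set` t]) -> (size s <= size t)%N.
Proof.
elim: s B t => // x s IH B t /= [nBx Is] st.
have {nBx} [t1 [y [t2 [def_t xt1y nxt1]]]] : exists t1 y t2,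
  [/\ t = t1 ++ y :: t2, cl (B `|` [set` t1] `|` [set y]) x
    & ~ cl (B `|` [set` t1]) x].
  have: cl (B `|` [set` t]) x by apply: st; rewrite /= mem_head.
  elim/last_ind: {IH st} t => [|t y IHt]; first by rewrite set_nil setU0.
  rewrite -cats1 => xty; have [/IHt[t1 [z [t2 [-> h1 h2]]]]|ntx] :=
    pselect (cl (B `|` [set` t]) x).
    by exists t1, z, (t2 ++ [:: y]); rewrite -catA.
  exists t, y, [::]; split=> //; apply: cl_mono xty => z [|].
    by left; left.
  by rewrite /= mem_cat inE => /orP[zt|/eqP ->]; [left; right|right].
have yx := cl_exch xt1y nxt1.
rewrite def_t size_cat /= addnS ltnS -size_cat; apply: IH Is _ => z zs.
have : cl (B `|` [set` t]) z by apply: st; rewrite /= inE zs orbT.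
apply: cl_trans; rewrite def_t => {z zs}.
move=> w [Bw|]; first by apply: cl_sub; left; left.
rewrite /= mem_cat inE => /or3P[wt|/eqP->|wt].
- by apply: cl_sub; right; rewrite /= mem_cat wt.
- apply: cl_mono yx => u [[]|->]; [by left; left| |by left; right].
  by move=> /= ut; right; rewrite /= mem_cat ut.
- by apply: cl_sub; right; rewrite /= mem_cat wt orbT.
Qed.

Lemma indep_anti B C s : C `<=` cl B -> indep B s -> indep C s.
Proof.
elim: s B C => //= x s IH B C CB [nBx Is]; split.
  by move=> Cx; apply: nBx; apply: cl_trans Cx.
apply: IH Is => y [/CB By|->]; first by apply: cl_mono By => z; left.
by apply: cl_sub; right.
Qed.

Lemma basis_exists B t : exists s,
  [/\ [set` s] `<=` [set` t], indep B s, size s = rk B t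
    & [set` t] `<=` cl (B `|` [set` s])].
Proof.
elim: t B => [|x t IH] B /=.
  by exists [::]; split=> // y; rewrite set_nil.
have [s [st Is ss ts]] := IH (B `|` [set x]).
case: asboolP => Bx /=; last first.
  exists (x :: s); split=> //=.
  - by move=> y; rewrite /= !inE => /orP[->//|/st /= ->]; rewrite orbT.
  - by rewrite ss.
  - rewrite [in X in cl X]set_seq_cons setUA => y;
      rewrite /= inE => /orP[/eqP->|]; last exact: ts.
    by apply: cl_sub; left; right.
have cle : B `|` [set x] `<=` cl B by move=> y [|->//]; exact: cl_sub.
exists s; split=> //.
- by move=> y /st; rewrite /= inE orbC => ->.
- by apply: indep_anti Is => y By; apply: cl_sub; left.
- move=> y; rewrite /= inE => /orP[/eqP->|yt]; first by apply: cl_mono Bx; left.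
  have := ts y yt; apply: cl_trans => z [/cle Bz|zs].
    by apply: cl_mono Bz; left.
  by apply: cl_sub; right.
Qed.

Lemma rk_ge B s t :
  indep B s -> [set` s] `<=` cl (B `|` [set` t]) -> (size s <= rk B t)%N.
Proof.
move=> Is st; have [b [_ _ <- tb]] := basis_exists B t.
apply: steinitz Is _ => y /st; apply: cl_trans => z [Bz|/tb//].
by apply: cl_sub; left.
Qed.

Lemma rk_indep B s : indep B s -> rk B s = size s.
Proof.
by elim: s B => //= x s IH B [nBx /IH ->]; case: asboolP.
Qed.

(** Only the closure of a list matters for its rank, not its order or repetitions. *)
Lemma rk_le B s t : [set` s] `<=` cl (B `|` [set` t]) -> (rk B s <= rk B t)%N.
Proof.
move=> st; have [b [bs Ib <- _]] := basis_exists B s.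
by apply: rk_ge Ib _ => y /bs /st.
Qed.

(** Together with [rk_cat] this splits the rank of s along any list t in its closure. *)
Lemma rk_subcat B s t : [set` t] `<=` cl (B `|` [set` s]) ->
  rk B (t ++ s) = rk B s.
Proof.
move=> ts; apply/eqP; rewrite eqn_leq; apply/andP; split; apply: rk_le => y /=.
  by rewrite mem_cat => /orP[/ts//|ys]; apply: cl_sub; right.
by move=> ys; apply: cl_sub; right; rewrite /= mem_cat ys orbT.
Qed.

(** The set W may be infinite, so the greedy algorithm cannot run through it; instead an independent
    list is extended until the bound stops it. *)
Lemma max_indep_exists (B W : set T) N :
  (forall s, indep B s -> [set` s] `<=` W -> (size s <= N)%N) ->
  exists s, [/\ indep B s, [set` s] `<=` W & W `<=` cl (B `|` [set` s])].
Proof.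
move=> bound.
(* The number m measures the room left: each extension lengthens s and lowers m. *)
suff H m s : indep B s -> [set` s] `<=` W -> (N < size s + m)%N ->
  exists s', [/\ indep B s', [set` s'] `<=` W & W `<=` cl (B `|` [set` s'])].
  by apply: (H N.+1 [::]) => // y; rewrite set_nil.
elim: m s => [|m IH] s sP sW lts.
  by have := bound s sP sW; rewrite leqNgt -[size s]addn0 lts.
have [Ws|/existsNP[y /not_implyP[Wy nsy]]] :=
  pselect (W `<=` cl (B `|` [set` s])).
  by exists s.
apply: (IH (s ++ [:: y])); last by rewrite size_cat addnAC addn1 addnS in lts *.
  by rewrite indep_cat.
by move=> z; rewrite /= mem_cat inE => /orP[/sW|/eqP ->].
Qed.

End Rank.

(** * Algebraic closure inside a field *)

Section SubfieldType.
Variables (K : fieldType) (S : divringClosed K).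

(** Makes a subfield, given as a set, into a field type, so that the theory of field morphisms and
    algebraic elements applies to it. *)
Record subfield_type := Subfield { subfield_val : K; _ : subfield_val \in S }.

HB.instance Definition _ := [isSub for subfield_val].
HB.instance Definition _ := [Choice of subfield_type by <:].
HB.instance Definition _ :=
  [SubChoice_isSubIntegralDomain of subfield_type by <:].
HB.instance Definition _ :=
  [SubIntegralDomain_isSubField of subfield_type by <:].

End SubfieldType.

(** Turns a question over a set S into one over a field k mapped into K, where polynomials with
    coefficients in k are available. *)
Lemma subfield_range (K : fieldType) (S : set K) : subfield S ->
  exists (k : fieldType) (f : {rmorphism k -> K}), range f = S.
Proof.
move=> divS; pose S' : divringClosed K :=
  HB.pack (fun x => x \in S)
    (GRing.isDivringClosed.Build K (fun x => x \in S) divS).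
exists (subfield_type S'), (val : {rmorphism subfield_type S' -> K}).
apply/seteqP; split=> [_ [x _ <-]|x /mem_set Sx] /=;
  first exact/set_mem/(valP x).
by exists (Subfield (Sx : x \in S')).
Qed.

Lemma subfieldP (K : fieldType) (S : set K) : subfield S <->
  [/\ S 1, forall x y, S x -> S y -> S (x - y)
    & forall x y, S x -> S y -> S (x / y)].
Proof.
split=> [[S1 SB SM]|[S1 SB SM]]; split.
- exact: set_mem S1.
- by move=> x y /mem_set Sx /mem_set Sy; apply/set_mem/SB.
- by move=> x y /mem_set Sx /mem_set Sy; apply/set_mem/SM.
- exact: mem_set S1.
- by move=> x y /set_mem Sx /set_mem Sy; apply/mem_set/SB.
- by move=> x y /set_mem Sx /set_mem Sy; apply/mem_set/SM.
Qed.

Lemma subfield_ops (K : fieldType) (S : set K) : subfield S ->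
  [/\ S 0, forall x y, S x -> S y -> S (x + y)
    & forall x y, S x -> S y -> S (x * y)].
Proof.
move=> /subfield_range[k [f <-]]; split; first by exists 0; rewrite ?rmorph0.
  by move=> _ _ [x _ <-] [y _ <-]; exists (x + y); rewrite ?rmorphD.
by move=> _ _ [x _ <-] [y _ <-]; exists (x * y); rewrite ?rmorphM.
Qed.

Lemma subfield_genP (K : fieldType) (X : set K) : subfield (subfield_gen X).
Proof.
apply/subfieldP; split=> [A [/subfieldP[]]//|x y Sx Sy A AP|x y Sx Sy A AP];
  by have /subfieldP[_ AB AM] := AP.1; (apply: AB || apply: AM);
    [apply: Sx|apply: Sy].
Qed.

Lemma subfield_gen_sub (K : fieldType) (X : set K) : X `<=` subfield_gen X.
Proof. exact: sub_gen_smallest. Qed.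

Lemma subfield_gen_min (K : fieldType) (X S : set K) :
  subfield S -> X `<=` S -> subfield_gen X `<=` S.
Proof. exact: smallest_sub. Qed.

Lemma subfield_rangeP (k K : fieldType) (f : {rmorphism k -> K}) :
  subfield (range f).
Proof.
apply/subfieldP; split; first by exists 1; rewrite ?rmorph1.
  by move=> _ _ [x _ <-] [y _ <-]; exists (x - y); rewrite ?rmorphB.
by move=> _ _ [x _ <-] [y _ <-]; exists (x / y); rewrite ?fmorph_div.
Qed.

Definition algebraic_over (K : fieldType) (S : set K) (x : K) : Prop :=
  exists p : {poly K}, [/\ p != 0, forall i, S p`_i & root p x].

Lemma algebraic_over_range (k K : fieldType) (f : {rmorphism k -> K}) x :
  algebraic_over (range f) x <-> algebraicOver f x.
Proof.
split=> [[p [p0 pf px]]|[p p0 px]]; last first.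
  exists (map_poly f p); split=> //; first by rewrite map_poly_eq0.
  by move=> i; rewrite coef_map; exists p`_i.
have /boolp.choice[g gP] : forall i, exists c, f c = p`_i.
  by move=> i; have [c _ <-] := pf i; exists c.
pose q := \poly_(i < size p) g i.
have defp : p = map_poly f q.
  apply/polyP=> i; rewrite coef_map coef_poly /=; case: ltnP => [_|lep].
    by rewrite gP.
  by rewrite rmorph0 nth_default.
by exists q; rewrite -?defp //; apply: contra_neq p0; rewrite defp => ->;
  rewrite rmorph0.
Qed.

Section AlgebraicClosure.
Variable K : fieldType.
Implicit Types (S B C : set K) (x y : K).

Lemma sub_algebraic S : subfield S -> S `<=` algebraic_over S.
Proof.
move=> /subfield_range[k [f <-]] _ [x _ <-].
exact/algebraic_over_range/algebraic_id.
Qed.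

Lemma algebraic_subfield S : subfield S -> subfield (algebraic_over S).
Proof.
move=> /subfield_range[k [f <-]]; apply/subfieldP; split.
- exact/algebraic_over_range/algebraic1.
- move=> x y /algebraic_over_range ax /algebraic_over_range ay.
  exact/algebraic_over_range/algebraic_sub.
- move=> x y /algebraic_over_range ax /algebraic_over_range ay.
  exact/algebraic_over_range/algebraic_div.
Qed.

(** Over a field algebraic means integral, and a root of a polynomial with integral coefficients is
    integral. *)
Lemma algebraic_trans S :
  subfield S -> algebraic_over (algebraic_over S) `<=` algebraic_over S.
Proof.
move=> /subfield_range[k [f <-]] x [p [p0 pS px]].
apply/algebraic_over_range/integral_algebraic/(integral_root p0 px).
move=> _ /(nthP 0)[i _ <-].
by have /algebraic_over_range/integral_algebraic := pS i.
Qed.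

Lemma algebraic_over_sub S S' :
  S `<=` S' -> algebraic_over S `<=` algebraic_over S'.
Proof. by move=> SS' x [p [p0 pS px]]; exists p; split=> // i; apply: SS'. Qed.

Definition acl B : set K := algebraic_over (subfield_gen B).

Lemma acl_subfield B : subfield (acl B).
Proof. exact/algebraic_subfield/subfield_genP. Qed.

Lemma acl_sub B : B `<=` acl B.
Proof.
move=> x Bx; apply: sub_algebraic; first exact: subfield_genP.
exact: subfield_gen_sub.
Qed.

Lemma acl_trans B C : B `<=` acl C -> acl B `<=` acl C.
Proof.
move=> BC x Bx; apply: algebraic_trans; first exact: subfield_genP.
apply: algebraic_over_sub Bx; apply: subfield_gen_min => //.
exact: acl_subfield.
Qed.

(** The element x is a root of X^m - x^m, whose coefficients lie in [acl B]. This serves for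
    exponentials of rational multiples. *)
Lemma acl_root B x m : (0 < m)%N -> acl B (x ^+ m) -> acl B x.
Proof.
move=> m0 Bxm; apply: algebraic_trans; first exact: subfield_genP.
have [B1 BB _] := (subfieldP _).1 (acl_subfield B).
have [B0 _ _] := subfield_ops (acl_subfield B).
exists ('X^m - (x ^+ m)%:P); split.
- exact: monic_neq0 (monicXnsubC _ m0).
- move=> i; rewrite coefB coefXn coefC; apply: BB; first by case: eqP.
  by case: eqP.
- by rewrite rootE !hornerE subrr.
Qed.

End AlgebraicClosure.

(** * Algebraic independence and transcendence degree *)

Lemma eq_mmap (n : nat) (R S : comNzRingType) (f f' : R -> S)
    (h h' : 'I_n -> S) p :
  f =1 f' -> h =1 h' -> mmap f h p = mmap f' h' p.
Proof.
by move=> eqf eqh; apply: eq_bigr => m _; rewrite eqf (mmap1_eq _ eqh).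
Qed.

Lemma rmorph_mmap (n : nat) (R S T : comNzRingType) (g : {rmorphism S -> T})
    (f : R -> S) (h : 'I_n -> S) p :
  g (mmap f h p) = mmap (g \o f) (g \o h) p.
Proof.
rewrite raddf_sum; apply: eq_bigr => m _ /=;
  rewrite rmorphM /mmap1 rmorph_prod /=.
by congr (_ * _); apply: eq_bigr => i _; rewrite rmorphXn.
Qed.

Lemma mmap_id (n : nat) (R : comNzRingType) (p : {mpoly R[n]}) :
  mmap (@mpolyC n R) (fun i => 'X_i) p = p.
Proof.
by rewrite [RHS]mpolyE; apply: eq_bigr => m _; rewrite mmap1_id mul_mpolyC.
Qed.

(** Splitting off the last variable turns evaluation into that of a univariate polynomial, which
    allows induction on the number of variables. *)
Lemma mmap_muni (R S : comNzRingType) (f : {rmorphism R -> S}) n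
    (z : 'I_n.+1 -> S) (p : {mpoly R[n.+1]}) :
  mmap f z p =
  (map_poly (mmap f (z \o widen_ord (leqnSn n))) (muni p)).[z ord_max].
Proof.
rewrite muniE raddf_sum horner_sum; apply: eq_bigr => m _ /=.
rewrite -mul_polyC rmorphM /= map_polyC /= hornerCM map_polyXn hornerXn.
rewrite mmapZ mmapX -mulrA /mmap1 big_ord_recr /=; congr (_ * (_ * _)).
by apply: eq_bigr => i _; rewrite mnmE.
Qed.

Lemma muni_inj (R : comNzRingType) n (p : {mpoly R[n.+1]}) :
  muni p = 0 -> p = 0.
Proof. by move=> p0; rewrite -[LHS]mmap_id mmap_muni p0 rmorph0 horner0. Qed.

Lemma muniX_widen (R : comNzRingType) n (i : 'I_n) :
  muni ('X_(widen_ord (leqnSn n) i) : {mpoly R[n.+1]}) = ('X_i)%:P.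
Proof.
rewrite /muni mmapX mmap1U; case: splitP => [j eq|j].
  by congr ('X__)%:P; apply/val_inj; rewrite /= -eq.
by move=> /eqP; rewrite ord1 /= addn0 ltn_eqF.
Qed.

Lemma muniX_max (R : comNzRingType) n :
  muni ('X_ord_max : {mpoly R[n.+1]}) = 'X.
Proof.
rewrite /muni mmapX mmap1U; case: splitP => // -[j ltjn] /= /eqP.
by rewrite gtn_eqF.
Qed.

Lemma muni_mwiden (R : comNzRingType) n (p : {mpoly R[n]}) :
  muni (mwiden p) = p%:P.
Proof.
rewrite /mwiden rmorph_mmap -[in RHS](mmap_id p) rmorph_mmap.
by apply: eq_mmap => [c|i] /=; [rewrite muniC|rewrite muniX_widen].
Qed.

Lemma muniK (R : comNzRingType) n (P : {poly {mpoly R[n]}}) :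
  muni (mmulti P) = P.
Proof.
rewrite /mmulti raddf_sum /= -[RHS]coefK poly_def; apply: eq_bigr => i _.
by rewrite rmorphM rmorphXn /= muni_mwiden muniX_max mul_polyC.
Qed.

(** * Fields of fractions and clearing of denominators *)

Section CommonDenominator.
Variables (R : comNzRingType) (K : fieldType) (g : {rmorphism R -> K}).

(** For g an evaluation of polynomials at a point, this is the field generated by the coefficients
    and the point. *)
Definition fraction (x : K) : Prop := exists p q, g q != 0 /\ x = g p / g q.

Lemma fraction_subfield : subfield fraction.
Proof.
apply/subfieldP; split.
- by exists 1, 1; rewrite rmorph1 oner_neq0 divr1.
- move=> _ _ [p [q [q0 ->]]] [p' [q' [q'0 ->]]].
  exists (p * q' - p' * q), (q * q').
  by rewrite rmorphB !rmorphM mulf_neq0 //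
    -[- (g p' / _)]mulNr addf_div // mulNr.
- move=> _ _ [p [q [q0 ->]]] [p' [q' [q'0 ->]]].
  have [->|p'0] := eqVneq (g p') 0.
    by exists 0, 1; rewrite !(mul0r, invr0, mulr0) rmorph0 rmorph1 oner_neq0
      mul0r.
  by exists (p * q'), (q * p'); rewrite !rmorphM mulf_neq0 // invf_div mulf_div.
Qed.

Lemma fraction_sub x : fraction (g x).
Proof. by exists x, 1; rewrite rmorph1 oner_neq0 divr1. Qed.

Lemma common_denominator (p : {poly K}) : (forall i, fraction p`_i) ->
  exists d (P : {poly R}), g d != 0 /\ map_poly g P = g d *: p.
Proof.
elim/poly_ind: p => [|p c IH] fr.
  by exists 1, 0; rewrite rmorph1 oner_neq0 rmorph0 scaler0.
have /IH[d [P [d0 defP]]] : forall i, fraction p`_i.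
  by move=> i; have := fr i.+1; rewrite coefD coefMX coefC addr0.
have := fr 0; rewrite coefD coefMX coefC add0r => -[a [b [b0 ->]]].
exists (d * b), (b *: P * 'X + (d * a)%:P).
rewrite rmorphM mulf_neq0 //= rmorphD rmorphM /= map_polyX map_polyC /=
  map_polyZ.
rewrite defP scalerA scalerDr; split=> //; congr (_ + _).
  by rewrite [g d * _]mulrC -scalerAl.
by rewrite rmorphM /= -mul_polyC -polyCM mulrACA divff // mulr1.
Qed.

End CommonDenominator.

Section FreeOver.
Variables (k K : fieldType) (f : {rmorphism k -> K}).

Definition free_over n (z : 'I_n -> K) : Prop :=
  forall p : {mpoly k[n]}, mmap f z p = 0 -> p = 0.

Lemma map_mpoly_eq0 n (p : {mpoly k[n]}) : map_mpoly f p = 0 -> p = 0.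
Proof.
move=> /mpolyP p0; apply/mpolyP => m; have := p0 m.
by rewrite mcoeff_map_mpoly !mcoeff0 => /eqP; rewrite fmorph_eq0 => /eqP.
Qed.

Lemma meval_map_mpoly n (z : 'I_n -> K) p : (map_mpoly f p).@[z] = mmap f z p.
Proof.
rewrite /map_mpoly rmorph_mmap.
by apply: eq_mmap => [c|i] /=; [rewrite mevalC|rewrite mevalXU].
Qed.

Lemma mmap_subfield n (S : set K) (z : 'I_n -> K) p :
  subfield S -> (forall c, S (f c)) -> (forall i, S (z i)) -> S (mmap f z p).
Proof.
move=> fieldS Sf Sz; have [S0 SD SM] := subfield_ops fieldS.
have [S1 _ _] := (subfieldP _).1 fieldS.
apply: (big_ind S) => [||m _]; [exact: S0|exact: SD|apply: (SM) => //].
apply: (big_ind S) => [||l _]; [exact: S1|exact: SM|].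
by elim: (m l) => [|e IH]; rewrite ?expr0 // exprS; apply: (SM).
Qed.

Lemma alg_indep_range n (z : 'I_n -> K) : alg_indep (range f) z <-> free_over z.
Proof.
split=> [zP p pz|zP p pf pz].
  apply: map_mpoly_eq0; apply: zP; last by rewrite meval_map_mpoly.
  by move=> m; rewrite mcoeff_map_mpoly; exists p@_m.
have /boolp.choice[g gP] : forall m, exists c, f c = p@_m.
  by move=> m; have [c _ <-] := pf m; exists c.
pose q := \sum_(m <- msupp p) g m *: 'X_[m].
have defp : p = map_mpoly f q.
  by rewrite [LHS]mpolyE raddf_sum; apply: eq_bigr => m _ /=;
    rewrite map_mpolyZ map_mpolyX gP.
by rewrite defp [q]zP ?rmorph0 // -meval_map_mpoly -defp.
Qed.

Lemma subfield_gen_fraction n (z : 'I_n -> K) :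
  subfield_gen (range f `|` range z) `<=` fraction (mmap f z).
Proof.
apply: subfield_gen_min; first exact: (fraction_subfield (mmap f z)).
move=> _ [[c _ <-]|[i _ <-]].
  by have := fraction_sub (mmap f z) c%:MP; rewrite /= mmapC.
by have := fraction_sub (mmap f z) 'X_i; rewrite /= mmapX mmap1U.
Qed.

(** A polynomial over the field generated by the other coordinates that kills the last one becomes,
    after clearing denominators, a relation among all. Conversely, a nonzero relation is read as a
    polynomial in the last variable; some coefficient stays nonzero at the other coordinates because
    these are free. *)
Lemma free_over_last n (z : 'I_n.+1 -> K) (z' := z \o widen_ord (leqnSn n)) :
  free_over z <-> free_over z' /\ ~ acl (range f `|` range z') (z ord_max).
Proof.
split=> [zP|[z'P zmax] p pz].
  split=> [p pz|[q [q0 qz qmax]]].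
    have : mwiden p = 0.
      by apply: zP; rewrite mmap_muni muni_mwiden map_polyC hornerC.
    by move/(congr1 (@muni _ _)); rewrite muni_mwiden muni0 => /polyC_inj.
  have /common_denominator[d [P [d0 defP]]] :
      forall i, fraction (mmap f z') q`_i.
    by move=> i; apply: subfield_gen_fraction.
  have P0 : mmulti P = 0.
    by apply: zP; rewrite mmap_muni muniK defP hornerZ (rootP qmax) mulr0.
  move: defP; rewrite -[P]muniK P0 muni0 rmorph0 => /esym/eqP.
  by rewrite scaler_eq0 (negPf d0) (negPf q0).
apply: muni_inj; apply/polyP => i; rewrite coef0; apply: z'P.
rewrite -coef_map /=; apply: contra_notP zmax => /eqP pi0.
exists (map_poly (mmap f z') (muni p)); split.
- by apply: contra_neq pi0 => ->; rewrite coef0.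
- move=> j; rewrite coef_map /=.
  apply: mmap_subfield => [|c|l]; first exact: subfield_genP.
    by apply: subfield_gen_sub; left; exists c.
  by apply: subfield_gen_sub; right; exists l.
- by rewrite rootE -mmap_muni pz.
Qed.

End FreeOver.

Section TranscendenceDegree.
Variable K : fieldType.
Implicit Types (B X : set K).

Lemma acl_subfield_gen B X : acl (subfield_gen B `|` X) = acl (B `|` X).
Proof.
apply/seteqP; split; apply: acl_trans => x [Bx|Xx].
- apply: sub_algebraic; first exact: subfield_genP.
  apply: subfield_gen_min Bx; first exact: subfield_genP.
  by move=> y By; apply: subfield_gen_sub; left.
- by apply: acl_sub; right.
- by apply: acl_sub; left; apply: subfield_gen_sub.
- by apply: acl_sub; right.
Qed.

Lemma indep_subfield_gen B s :
  indep (@acl K) (subfield_gen B) s <-> indep (@acl K) B s.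
Proof.
(* The base grows along the list, so the induction needs an additional set X. *)
suff H X :
    indep (@acl K) (subfield_gen B `|` X) s <-> indep (@acl K) (B `|` X) s.
  by have := H set0; rewrite !setU0.
by elim: s X => //= x s IH X; rewrite acl_subfield_gen -!setUA IH.
Qed.

Lemma free_over_indep (k : fieldType) (f : {rmorphism k -> K}) n
    (z : 'I_n -> K) :
  free_over f z <-> indep (@acl K) (range f) (codom z).
Proof.
elim: n z => [|n IH] z.
  have -> : codom z = [::] by apply: size0nil; rewrite size_codom card_ord.
  split=> // _ p; have -> : p = (p@_0%MM)%:MP.
    apply/mpolyP => m; have -> : m = 0%MM by apply/mnmP => -[].
    by rewrite mcoeffC eqxx mulr1.
  by rewrite mmapC => /eqP; rewrite fmorph_eq0 => /eqP ->.
rewrite free_over_last IH codom_ordSr -cats1 indep_cat /= set_codom.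
by split=> [[? ?]|[? []]].
Qed.

Lemma free_over_perm (k : fieldType) (f : {rmorphism k -> K}) n (z : 'I_n -> K)
    (s : 'S_n) :
  free_over f z -> free_over f (z \o s).
Proof.
move=> zP p pz; apply: (@inj_msym _ _ s); rewrite msym0; apply: zP.
rewrite -pz /msym rmorph_mmap.
by apply: eq_mmap => [c|i] /=; [rewrite mmapC|rewrite mmapX mmap1U].
Qed.

(* Algebraic independence of a pair does not depend on the order of the pair. *)
Lemma acl_exchange : exchange_closure (@acl K).
Proof.
split=> [B|B C|B x y xy nBy]; [exact: acl_sub|exact: acl_trans|].
apply: contra_notP nBy => nyx; have [//|nBy] := pselect (acl B y).
have [k [f fB]] := subfield_range (subfield_genP B).
have zP : free_over f (tnth [tuple y; x]).
  by apply/free_over_indep; rewrite fB codom_tnth indep_subfield_gen.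
have /free_over_indep := free_over_perm (s := tperm 0 1) zP.
rewrite fB indep_subfield_gen.
have -> : codom (tnth [tuple y; x] \o tperm 0 1) = [:: x; y].
  rewrite /codom /image_mem -(map_tnth_enum [tuple x; y]).
  apply: eq_map => i /=; case: tpermP => [->|->|] //.
  by case: i => [[|[|[]]]] // ? /eqP h1 /eqP h2.
by case=> _ [].
Qed.

Lemma alg_indep_indep B n (z : 'I_n -> K) :
  alg_indep (subfield_gen B) z <-> indep (@acl K) B (codom z).
Proof.
have [k [f fB]] := subfield_range (subfield_genP B).
by rewrite -fB alg_indep_range free_over_indep fB indep_subfield_gen.
Qed.

(** A greedy basis of t attains the maximum. Any independent family in the generated field is
    algebraic over B and t, so the exchange property bounds its length. *)
Lemma trdegE B (t : seq K) :
  trdeg (subfield_gen B) (subfield_gen (B `|` [set` t])) = rk (@acl K) B t.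
Proof.
apply: max_natE => [|m [z [zt /alg_indep_indep zP]]].
  have [s [st sP <- _]] := basis_exists acl_exchange B t.
  exists (tnth (in_tuple s)); split.
    by move=> i; apply: subfield_gen_sub; right; apply: st; apply: mem_tnth.
  by apply/alg_indep_indep; rewrite codom_tnth.
rewrite -[m]card_ord -(size_codom z); apply: (rk_ge acl_exchange zP).
move=> _ /= /codomP[i ->]; apply: sub_algebraic; first exact: subfield_genP.
exact: zt.
Qed.

End TranscendenceDegree.

(** * Rational linear spans *)

Section RationalSpan.
Variable K : fieldType.
Hypothesis K0 : [pchar K] =i pred0.
Implicit Types (B X : set K).

Lemma char0_intr_eq0 (m : int) : (m%:~R == 0 :> K) = (m == 0).
Proof.
have /pcharf0P natr0 := K0.
by case: m => m; rewrite ?NegzE ?rmorphN ?oppr_eq0 /= natr0.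
Qed.

(** The value of [ratr] is computed from the reduced fraction; in characteristic 0,
    cross-multiplication allows any other representation. *)
Lemma ratr_frac (m d : int) :
  d != 0 -> ratr (m%:~R / d%:~R) = m%:~R / d%:~R :> K.
Proof.
move=> d0; set q := _ / _; rewrite /ratr.
apply/eqP; rewrite eqr_div ?char0_intr_eq0 ?denq_eq0 // -!rmorphM /=.
apply/eqP; congr _%:~R; apply: (@intr_inj rat); rewrite !rmorphM /= numqE /q.
by rewrite -/q mulrAC divfK // intr_eq0.
Qed.

(** Nonzero integers are invertible in characteristic 0, so fractions are added and multiplied in K
    as in Q. The morphism g lets the rules for morphisms be applied to [ratr]. *)
Lemma ratr_rmorphism : exists g : {rmorphism rat -> K}, g =1 ratr.
Proof.
have denq0 x : (denq x)%:~R != 0 :> K by rewrite char0_intr_eq0 denq_eq0.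
have denQ0 x : (denq x)%:~R != 0 :> rat by rewrite intr_eq0 denq_eq0.
have zm : zmod_morphism (@ratr K).
  move=> x y; rewrite -[x in LHS]divq_num_den -[y in LHS]divq_num_den -mulNr.
  rewrite addf_div // -rmorphN -!rmorphM -rmorphD /= ratr_frac ?mulf_neq0
    ?denq_eq0 //.
  by rewrite rmorphD !rmorphM rmorphN /= -addf_div // mulNr.
have mm : monoid_morphism (@ratr K).
  split=> [|x y]; first by rewrite -[1]/(1%:~R) ratr_int.
  rewrite -[x in LHS]divq_num_den -[y in LHS]divq_num_den mulf_div -!rmorphM /=.
  by rewrite ratr_frac ?mulf_neq0 ?denq_eq0 // !rmorphM /= -mulf_div.
pose zM := GRing.isZmodMorphism.Build rat K (@ratr K) zm.
pose mM := GRing.isMonoidMorphism.Build rat K (@ratr K) mm.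
by exists (HB.pack (@ratr K) zM mM : {rmorphism rat -> K}).
Qed.

Lemma Qspan_subspace X : Qsubspace (Qspan X).
Proof.
split=> [A [[]]//|x y Sx Sy A AP|q x Sx A AP].
  by have [_ AD _] := AP.1; apply: AD; [apply: Sx|apply: Sy].
by have [_ _ AZ] := AP.1; apply: AZ; apply: Sx.
Qed.

Lemma Qspan_sub X : X `<=` Qspan X.
Proof. exact: sub_gen_smallest. Qed.

Lemma Qspan_min X S : Qsubspace S -> X `<=` S -> Qspan X `<=` S.
Proof. exact: smallest_sub. Qed.

Lemma Qspan_mono X X' : X `<=` X' -> Qspan X `<=` Qspan X'.
Proof.
by move=> XX'; apply: Qspan_min (Qspan_subspace _) _ => x /XX';
  apply: Qspan_sub.
Qed.

Lemma QspanB X x y : Qspan X x -> Qspan X y -> Qspan X (x - y).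
Proof.
have [_ SD SZ] := Qspan_subspace X; have [g gE] := ratr_rmorphism.
move=> Sx Sy; apply: (SD) => //; have := SZ (-1) _ Sy.
by rewrite -gE rmorphN1 mulN1r.
Qed.

Lemma Qspan_setU1 B x y :
  Qspan (B `|` [set x]) y <-> exists q : rat, Qspan B (y - ratr q * x).
Proof.
have [g gE] := ratr_rmorphism.
have [S0 SD SZ] := Qspan_subspace B;
  have [T0 TD TZ] := Qspan_subspace (B `|` [set x]).
split=> [|[q yq]]; last first.
  rewrite -[y](subrK (ratr q * x)); apply: (TD).
    by apply: Qspan_mono yq => z; left.
  by apply: (TZ); apply: Qspan_sub; right.
move: y; apply: (@Qspan_min _
  [set y | exists q : rat, Qspan B (y - ratr q * x)]) => [|y].
  split=> [|y z [q yq] [r zr]|q y [r yr]].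
  - by exists 0; rewrite -gE rmorph0 mul0r subr0.
  - exists (q + r); rewrite -gE rmorphD !gE mulrDl opprD addrACA; exact: SD.
  - by exists (q * r); rewrite -[ratr (q * r)]gE rmorphM !gE
      -[ratr q * ratr r * x]mulrA -mulrBr; apply: (SZ).
case=> [By|->].
  by exists 0; rewrite -gE rmorph0 mul0r subr0; apply: Qspan_sub.
by exists 1; rewrite -gE rmorph1 mul1r subrr.
Qed.

(** In y = b + q x the coefficient q is nonzero, as y is outside the span of B, so the equation can
    be solved for x. *)
Lemma Qspan_exchange : exchange_closure (@Qspan K).
Proof.
split=> [B|B C|B x y /Qspan_setU1[q yq] nBy]; first exact: Qspan_sub.
  by move=> BC; apply: Qspan_min BC; apply: Qspan_subspace.
have [g gE] := ratr_rmorphism; have [_ _ SZ] := Qspan_subspace B.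
have q0 : q != 0.
  by apply: contra_not_neq nBy => q0; move: yq;
    rewrite q0 -gE rmorph0 mul0r subr0.
apply/Qspan_setU1; exists q^-1.
have := SZ (- q^-1) _ yq;
  rewrite -!gE rmorphN mulNr mulrBr opprB mulrA -rmorphM.
by rewrite mulVf // rmorph1 mul1r.
Qed.

Definition Qindep B n (y : 'I_n -> K) : Prop :=
  forall q : 'I_n -> rat,
    Qspan B (\sum_i ratr (q i) * y i) -> forall i, q i = 0.

Lemma Qspan_range B n (y : 'I_n -> K) v : Qspan (B `|` range y) v <->
  exists q : 'I_n -> rat, Qspan B (v - \sum_i ratr (q i) * y i).
Proof.
have [g gE] := ratr_rmorphism.
have [S0 SD SZ] := Qspan_subspace B;
  have [T0 TD TZ] := Qspan_subspace (B `|` range y).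
split=> [|[q vq]]; last first.
  rewrite -[v](subrK (\sum_i ratr (q i) * y i)); apply: (TD).
    by apply: Qspan_mono vq => z; left.
  apply: (big_ind (Qspan (B `|` range y))) => [||i _]; [exact: T0|exact: TD|].
  by apply: (TZ); apply: Qspan_sub; right; exists i.
move: v; apply: (@Qspan_min _
  [set v | exists q : 'I_n -> rat, Qspan B (v - \sum_i ratr (q i) * y i)]) =>
    [|v].
  split=> [|v w [q vq] [r wr]|q v [r vr]].
  - exists (fun=> 0); rewrite big1 ?subr0 // => i _.
    by rewrite -gE rmorph0 mul0r.
  - exists (fun i => q i + r i).
    under eq_bigr do rewrite -gE rmorphD !gE mulrDl.
    by rewrite big_split opprD addrACA; apply: (SD).
  - exists (fun i => q * r i).
    under eq_bigr do rewrite -gE rmorphM !gE -[ratr _ * ratr _ * _]mulrA.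
    by rewrite -mulr_sumr -mulrBr; apply: (SZ).
case=> [Bv|[i _ <-]].
  exists (fun=> 0); rewrite big1 ?subr0; first exact: Qspan_sub.
  by move=> i _; rewrite -gE rmorph0 mul0r.
exists (fun j => (j == i)%:R); rewrite (bigD1 i) //= big1 => [|j /negPf ->].
  by rewrite eqxx -gE rmorph1 mul1r addr0 subrr.
by rewrite -gE rmorph0 mul0r.
Qed.

Lemma Qindep_indep B n (y : 'I_n -> K) :
  Qindep B y <-> indep (@Qspan K) B (codom y).
Proof.
have [g gE] := ratr_rmorphism.
elim: n y => [|n IH] y.
  have -> : codom y = [::] by apply: size0nil; rewrite size_codom card_ord.
  by split=> // _ q _ [].
rewrite codom_ordSr -cats1 indep_cat -IH /= set_codom.
set y' := y \o _.
(* Appends a last coefficient c to q. With c = 0 it prolongs a relation; with c = 1 and -q it turns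
   membership of the last vector in the span into a relation. *)
have snocE (q : 'I_n -> rat) (c : rat) : exists r : 'I_n.+1 -> rat,
    [/\ \sum_i ratr (r i) * y i = \sum_i ratr (q i) * y' i + ratr c * y ord_max,
       r \o widen_ord (leqnSn n) =1 q & r ord_max = c].
  pose r (i : 'I_n.+1) := oapp q c (insub (val i)).
  have rq i : r (widen_ord (leqnSn n) i) = q i by rewrite /r /= valK.
  have rc : r ord_max = c by rewrite /r insubF //= ltnn.
  exists r; split=> //; rewrite big_ord_recr /= rc.
  by under eq_bigr do rewrite rq.
split=> [yP|[y'P [ymax _]] q].
  split=> [q yq i|].
    have [r [rE rq _]] := snocE q 0; rewrite -rq; apply: yP.
    by rewrite rE -gE rmorph0 mul0r addr0.
  split=> // /Qspan_range[q yq]; have [r [rE _ r1]] := snocE (fun i => - q i) 1.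
  suff /yP/(_ ord_max)/eqP : Qspan B (\sum_i ratr (r i) * y i).
    by rewrite r1 oner_eq0.
  rewrite rE -gE rmorph1 mul1r addrC.
  by under eq_bigr do rewrite -gE rmorphN gE mulNr; rewrite sumrN.
rewrite big_ord_recr /= => yq.
have [_ _ SZ] := Qspan_subspace B.
have q0 : q ord_max = 0.
  apply: contra_notP ymax => /eqP q0; apply/Qspan_range.
  exists (fun i => - (q ord_max)^-1 * q (widen_ord (leqnSn n) i)).
  have := SZ (q ord_max)^-1 _ yq; rewrite mulrDr mulrA -!gE -rmorphM mulVf //.
  rewrite rmorph1 mul1r addrC mulr_sumr.
  under [X in Qspan B (_ - X)]eq_bigr do rewrite -gE rmorphM rmorphN mulNr gE
    mulNr.
  rewrite sumrN opprK; congr (Qspan B (_ + _)).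
  by apply: eq_bigr => i _; rewrite mulrA.
move: yq; rewrite q0 -gE rmorph0 mul0r addr0.
move=> /(y'P (q \o widen_ord (leqnSn n))) q'0 i.
case: (unliftP ord_max i) => [j|] ->; last exact: q0.
rewrite -(q'0 j) /=; congr q; apply: val_inj.
by rewrite /= /bump leqNgt ltn_ord.
Qed.

Lemma ldimE (s : seq K) B : ldim [set` s] B = rk (@Qspan K) B s.
Proof.
apply: max_natE => [|m [z [zs /Qindep_indep zP]]].
  have [b [bs bP <- _]] := basis_exists Qspan_exchange B s.
  exists (tnth (in_tuple b)); split.
    by move=> i; apply: Qspan_sub; left; apply: bs; apply: mem_tnth.
  by apply/Qindep_indep; rewrite codom_tnth.
rewrite -[m]card_ord -(size_codom z); apply: (rk_ge Qspan_exchange zP).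
by move=> _ /= /codomP[i ->]; rewrite setUC.
Qed.

(** The hypothesis says that passing to B' creates no new relations. It survives adding x to both
    bases: if u - q x lies in the span of B', it already lies in the span of B. This modular law is
    special to linear spans; algebraic closure does not satisfy it. *)
Lemma rk_modular B B' (s : seq K) :
  Qspan (B `|` [set` s]) `&` Qspan B' `<=` Qspan B ->
  (rk (@Qspan K) B s <= rk (@Qspan K) B' s)%N.
Proof.
elim: s B B' => //= x s IH B B' BB'; apply: leq_add.
  case: (asboolP (Qspan B x)) => // nBx; case: (asboolP (Qspan B' x)) => // B'x.
  by case: nBx; apply: BB'; split=> //; apply: Qspan_sub; right;
    rewrite /= mem_head.
apply: IH => u [+ /Qspan_setU1[q uq]]; rewrite -setUA -set_seq_cons => Bu.
apply/Qspan_setU1; exists q; apply: BB'; split=> //.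
apply: QspanB => //; have [_ _ SZ] := Qspan_subspace (B `|` [set` x :: s]).
by apply: (SZ); apply: Qspan_sub; right; rewrite /= mem_head.
Qed.

End RationalSpan.

(** * Common denominators and rational matrices acting on tuples *)

Lemma rat_common_denominator (I : finType) (q : I -> rat) :
  exists (d : int) (r : I -> int), d != 0 /\ forall i, d%:~R * q i = (r i)%:~R.
Proof.
exists (\prod_i denq (q i)),
  (fun i => numq (q i) * \prod_(j | j != i) denq (q j)).
split=> [|i]; first by apply/prodf_neq0 => i _; rewrite denq_eq0.
by rewrite (bigD1 i) //= !rmorphM /= numqE mulrAC [_ * q i]mulrC.
Qed.

Definition comb (K : fieldType) m n (P : 'M[rat]_(m, n)) (a : 'I_n -> K)
    (i : 'I_m) : K :=
  \sum_j ratr (P i j) * a j.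

Lemma comb_span (K : fieldType) (K0 : [pchar K] =i pred0) (B : set K) m n
    (P : 'M[rat]_(m, n)) (a : 'I_n -> K) i :
  Qspan (B `|` range a) (comb P a i).
Proof.
apply/(Qspan_range K0); exists (P i); rewrite subrr.
by have [] := Qspan_subspace B.
Qed.

Lemma comb_mul (K : fieldType) (K0 : [pchar K] =i pred0) l m n
    (P : 'M[rat]_(l, m)) (R : 'M[rat]_(m, n)) (a : 'I_n -> K) :
  comb (P *m R) a =1 comb P (comb R a).
Proof.
have [g gE] := ratr_rmorphism K0.
move=> i; rewrite /comb.
under eq_bigr do rewrite -gE mxE rmorph_sum mulr_suml.
rewrite exchange_big; apply: eq_bigr => j _; rewrite mulr_sumr.
by apply: eq_bigr => k _; rewrite rmorphM !gE mulrA.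
Qed.

(** The rows of a basis of the row space of P are independent, so they carry a to an independent
    tuple of length rk P, which spans the same space over B as the combinations given by P. *)
Lemma rk_comb (K : fieldType) (K0 : [pchar K] =i pred0) (B : set K) m n
    (P : 'M[rat]_(m, n)) (a : 'I_n -> K) :
  Qindep B a -> rk (@Qspan K) B (codom (comb P a)) = \rank P.
Proof.
move=> aP; pose y := comb (row_base P) a.
have yP : Qindep B y.
  move=> q yq i; pose Q := \row_i q i.
  have : comb Q y 0 = \sum_i ratr (q i) * y i.
    by apply: eq_bigr => j _; rewrite mxE.
  rewrite -comb_mul // => def_yq; move: yq; rewrite -def_yq => /aP QR0.
  have /eqP : Q *m row_base P = 0 by apply/rowP => j; rewrite QR0 mxE.
  rewrite mulmx_free_eq0 ?row_base_free // => /eqP/rowP/(_ i).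
  by rewrite !mxE.
have /submxP[D defP] : (P <= row_base P)%MS by rewrite eq_row_base.
have /submxP[E defR] : (row_base P <= P)%MS by rewrite eq_row_base.
have sub l (S : 'M_(l, n)) k (T : 'M_(k, n)) C : S = C *m T ->
    [set` codom (comb S a)] `<=` Qspan (B `|` [set` codom (comb T a)]).
  move=> -> _ /= /codomP[i ->]; rewrite set_codom comb_mul //; exact: comb_span.
have Qexch := Qspan_exchange K0.
have -> : rk (@Qspan K) B (codom (comb P a)) = rk (@Qspan K) B (codom y).
  by apply/eqP; rewrite eqn_leq !rk_le //; [apply: sub defR|apply: sub defP].
by rewrite rk_indep ?size_codom ?card_ord //; apply/(Qindep_indep K0).
Qed.

(** * The dimension of [M . V] *)

Section LaurentEvaluation.
Variables (F L : fieldType) (f : {rmorphism F -> L}) (n : nat).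
Implicit Types (v : gpoint n L) (M : 'M[int]_n) (p : laurent F n).

Lemma leval_lX v i : leval f v (lX F i) = v.1 i.
Proof.
rewrite /leval mmapX mmap1U /lvals.
by rewrite -[lshift n _]/(unsplit (inl (lshift n i))) unsplitK
  -[lshift n i]/(unsplit (inl i)) unsplitK.
Qed.

Lemma leval_lY v i : leval f v (lY F i) = v.2 i.
Proof.
rewrite /leval mmapX mmap1U /lvals.
by rewrite -[lshift n _]/(unsplit (inl (rshift n i))) unsplitK
  -[rshift n i]/(unsplit (inr i)) unsplitK.
Qed.

Lemma leval_lZ v i : leval f v (lZ F i) = (v.2 i)^-1.
Proof.
rewrite /leval mmapX mmap1U /lvals.
by rewrite -[rshift (n + n) _]/(unsplit (inr i)) unsplitK.
Qed.

Lemma leval_lYexp v i r : leval f v (lYexp F i r) = v.2 i ^ r.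
Proof.
by case: r => r; rewrite /lYexp /leval rmorphXn /= -/(leval f v _)
  ?leval_lY ?leval_lZ // exprVn NegzE.
Qed.

(** Pullback of functions along the action of M. The variable Z_i, which stands for Y_i^-1, goes to
    the product with opposite exponents. *)
Definition laurent_act M p : laurent F n :=
  mmap (@mpolyC _ F)
    (lvals (fun i => \sum_j lX F j *~ M i j)
       (fun i => \prod_j lYexp F j (M i j))
       (fun i => \prod_j lYexp F j (- M i j))) p.

Lemma leval_laurent_act v M p :
  leval f v (laurent_act M p) = leval f (mat_act M v) p.
Proof.
rewrite /leval /laurent_act rmorph_mmap; apply: eq_mmap => [c|i] /=.
  by rewrite mmapC.
rewrite /lvals; case: (split i) => [k|k]; last first.
  rewrite rmorph_prod /= -prodfV; apply: eq_bigr => j _ /=.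
  by rewrite -/(leval f v _) leval_lYexp invr_expz.
case: (split k) => j /=.
  by rewrite rmorph_sum; apply: eq_bigr => l _;
    rewrite rmorphMz /= -/(leval f v _) leval_lX.
by rewrite rmorph_prod; apply: eq_bigr => l _ /=;
  rewrite -/(leval f v _) leval_lYexp.
Qed.

Lemma meval_leval d (g : 'I_d -> laurent F n) v M (p : {mpoly F[d]}) :
  leval f v (mmap (@mpolyC _ F) (fun i => laurent_act M (g i)) p) =
  mmap f (fun i => leval f (mat_act M v) (g i)) p.
Proof.
rewrite {1}/leval rmorph_mmap; apply: eq_mmap => [c|i] /=;
  first by rewrite mmapC.
by rewrite -/(leval f v _) leval_laurent_act.
Qed.

End LaurentEvaluation.

Section GenericPoint.
Variables (F L : fieldType) (f : {rmorphism F -> L}) (n : nat).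
Variables (V : set (gpoint n F)) (v : gpoint n L).
Hypothesis v_generic : forall p, leval f v p = 0 <-> videal V p.

(** A polynomial in regular functions vanishes on M.V iff its pullback lies in I(V), iff the
    pullback vanishes at the generic point v. So functions independent on M.V are exactly those
    whose values at M.v are free over F. *)
Lemma vdimE (M : 'M[int]_n) :
  vdim (mat_act M @` V) =
  rk (@acl L) (range f) (codom (mat_act M v).1 ++ codom (mat_act M v).2).
Proof.
set w := mat_act M v.
have freeE d (g : 'I_d -> laurent F n) :
    (forall p : {mpoly F[d]},
        (forall u, (mat_act M @` V) u ->
           p.@[fun i => leval idfun u (g i)] = 0) -> p = 0) <->
    free_over f (fun i => leval f w (g i)).
  split=> H p pP; apply: H.
    move=> _ [u Vu <-].
    have := v_generic (mmap (@mpolyC _ F) (fun i => laurent_act M (g i)) p).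
    by rewrite meval_leval => -[/(_ pP) /(_ u Vu) + _];
      rewrite (meval_leval idfun).
  rewrite -meval_leval; apply/v_generic => u Vu.
  by rewrite (meval_leval idfun); apply: pP; exists u.
(* Every coordinate of M.v is the value of a regular function, so a basis chosen among the
   coordinates gives independent functions. *)
have coordP y : y \in codom w.1 ++ codom w.2 -> exists p, leval f w p = y.
  by rewrite mem_cat => /orP[] /codomP[i ->];
    [exists (lX F i); rewrite leval_lX|exists (lY F i); rewrite leval_lY].
apply: max_natE => [|d [g /freeE/free_over_indep gP]].
  have [s [st sP <- _]] :=
    basis_exists (@acl_exchange L) (range f) (codom w.1 ++ codom w.2).
  have /boolp.choice[g gE] : forall i : 'I_(size s), exists p,
      leval f w p = tnth (in_tuple s) i.
    by move=> i; apply/coordP/st/mem_tnth.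
  exists g; apply/freeE; rewrite (_ : (fun i => _) = tnth (in_tuple s));
    last exact/funext.
  by apply/free_over_indep; rewrite codom_tnth.
rewrite -[d]card_ord -(size_codom (fun i => leval f w (g i))).
apply: (rk_ge (@acl_exchange L) gP) => _ /= /codomP[i ->].
(* For the upper bound, values of Laurent polynomials are algebraic over the coordinates, since
   [acl] is a field and so contains the inverses of the multiplicative coordinates. *)
have aclF := @acl_subfield L (range f `|` [set` codom w.1 ++ codom w.2]).
have [a1 aB aV] := (subfieldP _).1 aclF.
have wP j : (w.1 j \in codom w.1 ++ codom w.2) &&
    (w.2 j \in codom w.1 ++ codom w.2).
  by rewrite !mem_cat !codom_f orbT.
apply: mmap_subfield => // [c|j]; first by apply: acl_sub; left; exists c.
rewrite /lvals; case: (split j) => [k|k]; last first.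
  rewrite -[_^-1]mul1r; apply: aV => //; apply: acl_sub; right.
  by have /andP[] := wP k.
by case: (split k) => l; apply: acl_sub; right; have /andP[] := wP l.
Qed.

End GenericPoint.

(** * Strong extensions *)

Section Strong.
Variables (F L : pefield) (f : {rmorphism F -> L}).
Hypotheses (domF : dom F = setT) (domL : dom L = setT).
Hypothesis fexp : forall x, pexp (f x) = f (pexp x).
Implicit Types (s : seq L) (x y : L) (B C : set L).

Let L0 := pe_char0 L.
Let expD x y : pexp (x + y) = pexp x * pexp y.
Proof. by apply: pexpD; rewrite domL. Qed.
Let exp_neq0 x : pexp x != 0. Proof. by apply: pexp_neq0; rewrite domL. Qed.

Lemma pexp0 : pexp (0 : L) = 1.
Proof. by apply: (mulIf (exp_neq0 0)); rewrite -expD addr0 mul1r. Qed.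

Lemma pexpMn x m : pexp (x *+ m) = pexp x ^+ m.
Proof.
elim: m => [|m IH]; first by rewrite mulr0n expr0 pexp0.
by rewrite mulrS exprS expD IH.
Qed.

Lemma pexpMz x (m : int) : pexp (x *~ m) = pexp x ^ m.
Proof.
case: m => m; first exact: pexpMn.
by apply: (mulIf (exp_neq0 (x *+ m.+1))); rewrite -expD NegzE mulrNz addNr pexp0
  pexpMn -exprnN mulVf // expf_neq0.
Qed.

Lemma pexp_sum (I : finType) (g : I -> L) :
  pexp (\sum_i g i) = \prod_i pexp (g i).
Proof. exact: (big_morph _ expD pexp0). Qed.

Definition expcat s : seq L := s ++ map (@pexp L) s.

Lemma mem_expcat s x : x \in s -> (x \in expcat s) && (pexp x \in expcat s).
Proof. by move=> xs; rewrite !mem_cat xs map_f ?orbT. Qed.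

Lemma deltaE m (x : 'I_m -> L) B :
  delta x B = (rk (@acl L) (B `|` @pexp L @` B) (expcat (codom x)))%:Z
              - (rk (@Qspan L) B (codom x))%:Z.
Proof.
rewrite /delta -(ldimE L0) set_codom -trdegE;
  congr (Posz (trdeg _ (subfield_gen (_ `|` _))) - _).
apply/seteqP; split=> y /=.
  case=> [[i _ <-]|[_ [i _ <-] <-]];
    first by have /andP[] := mem_expcat (codom_f x i).
  by have /andP[] := mem_expcat (codom_f x i).
rewrite mem_cat => /orP[/codomP[i ->]|/mapP[_ /codomP[i ->] ->]].
  by left; exists i.
by right; exists (x i) => //; exists i.
Qed.

Lemma delta_ge0 m (x : 'I_m -> L) B :
  0 <= delta x B <-> (rk (@Qspan L) B (codom x)
    <= rk (@acl L) (B `|` @pexp L @` B) (expcat (codom x)))%N.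
Proof. by rewrite deltaE subr_ge0 lez_nat. Qed.

Lemma range_exp : range f `|` @pexp L @` range f = range f.
Proof.
apply/seteqP; split=> x; last by left.
by case=> // -[_ [c _ <-] <-]; rewrite fexp; exists (pexp c).
Qed.

(* [exp (v / d)] is a [d]-th root of [exp v], so exponentials of rational
   linear combinations stay algebraic. *)
Lemma acl_exp_Qspan B C :
  (forall x, B x -> acl C x /\ acl C (pexp x)) ->
  forall x, Qspan B x -> acl C x /\ acl C (pexp x).
Proof.
move=> BC.
apply: (@Qspan_min _ _ [set x | acl C x /\ acl C (pexp x)]) => [|x /BC //].
have [k [g gC]] := subfield_range (acl_subfield C).
have [C0 CD CM] := subfield_ops (acl_subfield C).
have [C1 _ _] := (subfieldP _).1 (acl_subfield C).
split=> [|x y [Cx Cex] [Cy Cey]|q x [Cx Cex]] /=.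
- by rewrite pexp0.
- by rewrite expD; split; [apply: (CD)|apply: (CM)].
split; first by apply: (CM) => //; rewrite -gC -(fmorph_rat g); exists (ratr q).
apply: (@acl_root _ _ _ `|denq q|%N); first by rewrite absz_gt0 denq_eq0.
rewrite -pexpMn -mulr_natl.
have -> : (`|denq q|%N)%:R = (denq q)%:~R :> L by rewrite pmulrn absz_denq.
rewrite /ratr mulrA mulrCA divff ?mulr1;
  last by rewrite char0_intr_eq0 ?denq_eq0.
rewrite mulrzl pexpMz; move: Cex; rewrite -gC => -[c _ <-].
by exists (c ^ numq q) => //; rewrite fmorphXz.
Qed.

(** Links the two closures: a linear span over F, together with its exponentials, is algebraic over
    the spanning list and its exponentials. *)
Lemma acl_expcat s t : [set` t] `<=` Qspan (range f `|` [set` s]) ->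
  [set` expcat t] `<=` acl (range f `|` [set` expcat s]).
Proof.
move=> ts.
have H x : x \in t -> acl (range f `|` [set` expcat s]) x /\
    acl (range f `|` [set` expcat s]) (pexp x).
  move=> /ts; apply: acl_exp_Qspan => y [[c _ <-]|ys]; split; apply: acl_sub.
  - by left; exists c.
  - by left; exists (pexp c).
  - by right; have /andP[] := mem_expcat ys.
  - by right; have /andP[] := mem_expcat ys.
by move=> x; rewrite /= mem_cat => /orP[/H[]//|/mapP[y /H[_ ?] ->]].
Qed.

Lemma strongE : strong f <-> forall s,
  (rk (@Qspan L) (range f) s <= rk (@acl L) (range f) (expcat s))%N.
Proof.
rewrite /strong domF; split=> [H s|H m x _].
  have := H _ (tnth (in_tuple s)); rewrite delta_ge0 range_exp codom_tnth;
    apply.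
  by move=> i; rewrite domL.
by rewrite delta_ge0 range_exp.
Qed.

(** * Strength and rotundity at a generic point (a, exp a) of V *)

Section Generic.
Variables (n : nat) (V : set (gpoint n F)) (a : 'I_n -> L) (D : set L).
Let v : gpoint n L := (a, fun i => pexp (a i)).
Hypothesis v_generic : forall p, leval f v p = 0 <-> videal V p.
Hypothesis V_addfree : additively_free V.

Lemma Qspan_rangeE : Qspan (range f) = range f.
Proof.
apply/seteqP; split; last exact: Qspan_sub.
have [S0 SD SM] := subfield_ops (subfield_rangeP f).
apply: Qspan_min => //; split=> // q x Sx; apply: (SM) => //.
by exists (ratr q) => //; rewrite fmorph_rat.
Qed.

(** A rational relation modulo F, multiplied by a common denominator, is an integral linear equation
    satisfied by a. By genericity it belongs to I(V), against additive freeness. *)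
Lemma generic_Qindep : Qindep (range f) a.
Proof.
have [g gE] := ratr_rmorphism L0.
move=> q; rewrite Qspan_rangeE => -[c _ ca] i.
have [d [r [d0 rE]]] := rat_common_denominator q.
have rq j : (r j)%:~R = d%:~R * ratr (q j) :> L.
  by rewrite -gE -(rmorph_int g d) -rmorphM rE rmorph_int.
apply: contraPeq (V_addfree (r := r) (c := c *~ d)) => qi0 /(_ _)[].
  exists i; rewrite -(intr_eq0 rat) -rE mulf_neq0 ?intr_eq0 //; exact: qi0.
apply/v_generic; rewrite /leval mmapB mmapC rmorph_sum /= [f (c *~ d)]rmorphMz
  /= ca.
apply/eqP; rewrite subr_eq0 -mulrzl mulr_sumr; apply/eqP/eq_bigr => j _.
rewrite rmorphMz /= -/(leval f v _) leval_lX /= -mulrzl rq; apply: esym;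
  apply: mulrA.
Qed.

(** Since exp turns integral combinations into products of powers, M.v again has the form (x, exp
    x). *)
Lemma mat_act_exp (M : 'M[int]_n) i :
  (mat_act M v).2 i = pexp ((mat_act M v).1 i).
Proof. by rewrite /= pexp_sum; apply: eq_bigr => j _; rewrite pexpMz. Qed.

Lemma vdim_generic (M : 'M[int]_n) : vdim (mat_act M @` V) =
  rk (@acl L) (range f) (expcat (codom (mat_act M v).1)).
Proof.
rewrite (vdimE v_generic) /expcat /codom /image_mem -map_comp.
by congr (rk _ _ (_ ++ _)); apply: eq_map => i; rewrite mat_act_exp.
Qed.

Lemma rk_mat_act (M : 'M[int]_n) :
  rk (@Qspan L) (range f) (codom (mat_act M v).1) =
  \rank (map_mx intr M : 'M[rat]_n).
Proof.
rewrite -(rk_comb L0 _ generic_Qindep); congr rk; apply: eq_codom => i.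
by apply: eq_bigr => j _; rewrite mxE ratr_int mulrzl.
Qed.

Lemma rotund_of_strong : strong f -> rotund V.
Proof. by move=> /strongE fs M; rewrite vdim_generic -rk_mat_act. Qed.

(** This is delta(s / F) >= 0 for an independent s in F + span(a). Up to translation by F and a
    common factor d, such an s is a tuple M.a, to which rotundity applies. *)
Lemma rk_rotund s : rotund V -> indep (@Qspan L) (range f) s ->
  [set` s] `<=` Qspan (range f `|` range a) ->
  (size s <= rk (@acl L) (range f) (expcat s))%N.
Proof.
move=> rotV sP sa.
have [g gE] := ratr_rmorphism L0.
have Qexch := Qspan_exchange L0.
(* Rotundity is about n by n matrices, so the coefficient rows of s must number at most n before
   being padded. *)
have lesn : (size s <= n)%N.
  rewrite -[n]card_ord -(size_codom a); apply: (steinitz Qexch sP).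
  by rewrite set_codom.
pose z := tnth (in_tuple s).
have /boolp.choice[q qP] : forall i, exists q : 'I_n -> rat,
    Qspan (range f) (z i - \sum_j ratr (q j) * a j).
  by move=> i; apply/(Qspan_range L0); apply: (sa (z i)); apply: mem_tnth.
have [d [r [d0 rE]]] :=
  rat_common_denominator (fun ij : 'I_(size s) * 'I_n => q ij.1 ij.2).
(* Row i holds d times the coefficients of the i-th element of s; rows beyond the length of s take
   the default value 0. *)
pose M : 'M[int]_n :=
  \matrix_(i, j) oapp (fun i' => r (i', j)) 0 (insub (val i)).
pose x := (mat_act M v).1.
have rq i j : (r (i, j))%:~R = d%:~R * ratr (q i j) :> L.
  by rewrite -gE -(rmorph_int g d) -rmorphM (rE (i, j)) rmorph_int.
have xE (i : 'I_(size s)) :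
    x (widen_ord lesn i) = d%:~R * \sum_j ratr (q i j) * a j.
  rewrite mulr_sumr; apply: eq_bigr => j _.
  by rewrite mxE /= valK /= -mulrzl rq; apply: esym; apply: mulrA.
have x0 (i : 'I_n) : (size s <= i)%N -> x i = 0.
  by move=> lei; apply: big1 => j _; rewrite mxE insubF ?ltnNge ?lei.
have [_ _ SZ] := Qspan_subspace (range f `|` [set` s]).
have d0L : d%:~R != 0 :> L by rewrite char0_intr_eq0.
(* Now x and s have the same span over F: up to elements of F, one passes between them by
   multiplying or dividing by d. The inclusion [xs] compares transcendence degrees, and [sx] below
   compares linear ranks. *)
have xs : [set` codom x] `<=` Qspan (range f `|` [set` s]).
  move=> _ /= /codomP[i ->]; have [lti|lei] := ltnP i (size s); last first.
    by rewrite x0 //; have [] := Qspan_subspace (range f `|` [set` s]).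
  have -> : i = widen_ord lesn (Ordinal lti) by apply: val_inj.
  set i' := Ordinal lti; rewrite xE -ratr_int; apply: (SZ).
  rewrite -[X in Qspan _ X](subKr (z i')); apply: (QspanB L0).
    by apply: Qspan_sub; right; apply: mem_tnth.
  by apply: Qspan_mono (qP i') => y; left.
have sx : [set` s] `<=` Qspan (range f `|` [set` codom x]).
  move=> y ys; have [i ->] : exists i, y = z i.
    by have /tnthP[i] : y \in in_tuple s by []; exists i.
  rewrite -[z i](subrK (\sum_j ratr (q i j) * a j)).
  have [_ TD TZ] := Qspan_subspace (range f `|` [set` codom x]); apply: (TD).
    by apply: Qspan_mono (qP i) => w; left.
  rewrite -[X in Qspan _ X](mulKf d0L) -xE -[(d%:~R)^-1]mul1r.
  rewrite (_ : 1 / _ = ratr d%:~R^-1).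
    by apply: (TZ); apply: Qspan_sub; right; apply: codom_f.
  by rewrite -gE fmorphV rmorph_int mul1r.
apply: leq_trans (rk_le (@acl_exchange L) (acl_expcat xs)).
rewrite -vdim_generic; apply: leq_trans (rotV M).
by rewrite -rk_mat_act -(rk_indep sP); apply: (rk_le Qexch).
Qed.

Hypotheses (D_sub : Qsubspace D) (FD : range f `<=` D).
Hypothesis Da : D `<=` Qspan (range f `|` range a).
Hypothesis D_strong : forall s,
  (rk (@Qspan L) D s <= rk (@acl L) (D `|` @pexp L @` D) (expcat s))%N.

(** The tuple s is split along D: rotundity handles the part inside D, and [D_strong] the rest. *)
Lemma strong_of_rotund : rotund V -> strong f.
Proof.
move=> rotV; apply/strongE => s; have Qexch := Qspan_exchange L0.
(* Independent lists in W have length at most the rank of s over F, so W has a finite basis y over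
   F. *)
pose W := Qspan (range f `|` [set` s]) `&` D.
have [y [yP yW Wy]] : exists y : seq L,
    [/\ indep (@Qspan L) (range f) y, [set` y] `<=` W
      & W `<=` Qspan (range f `|` [set` y])].
  apply: (max_indep_exists (N := rk (@Qspan L) (range f) s)) => y yP yW.
  by apply: (rk_ge Qexch yP) => u /yW[].
have ys u : u \in y -> Qspan (range f `|` [set` s]) u by move=> /yW[].
have yD u : u \in y -> D u by move=> /yW[].
have QD : Qspan D = D.
  by apply/seteqP; split; [apply: Qspan_min|apply: Qspan_sub].
(* The span of F, y and s is that of F and s; it meets D in W, hence inside the span of F and y.
   This is the hypothesis of the modular law. *)
have lin : (rk (@Qspan L) (range f) s <= size y + rk (@Qspan L) D s)%N.
  rewrite -(rk_subcat Qexch ys) rk_cat (rk_indep yP) leq_add2l.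
  apply: (rk_modular L0) => u [uys]; rewrite QD => Du; apply: Wy; split=> //.
  apply: (Qspan_min (Qspan_subspace _)) uys => w [[wf|/ys//]|ws];
    apply: Qspan_sub.
    by left.
  by right.
(* Transcendence degree is additive along y and then s; enlarging the base F, y, exp y to D, exp D
   can only lower the second term. *)
have alg : (rk (@acl L) (range f) (expcat y)
      + rk (@acl L) (D `|` @pexp L @` D) (expcat s)
    <= rk (@acl L) (range f) (expcat s))%N.
  rewrite -[leqRHS](rk_subcat (@acl_exchange L) (acl_expcat ys)) [leqRHS]rk_cat
    leq_add2l.
  apply: (rk_anti (@acl_exchange L)) => u [/FD Du|].
    by apply: acl_sub; left.
  rewrite /= mem_cat => /orP[/yD Du|/mapP[w /yD Dw ->]]; apply: acl_sub.
    by left.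
  by right; exists w.
apply: leq_trans lin _; apply: leq_trans alg; apply: leq_add (D_strong s).
by apply: rk_rotund => // u /yD /Da.
Qed.

End Generic.
End Strong.

(** * Transfer of the criterion from the generic point to [F|V] *)

Theorem proposition5p2 (F : pefield) (n : nat) (V : set (gpoint n F))
    (F_ELA : ELA_field F) (F_countable : countable [set: F]%classic)
    (V_subvar : subvariety V) (V_irr : irreducible V)
    (V_addfree : additively_free V) (V_mulfree : multiplicatively_free V)
    (V_kummer : kummer_generic V)
    (L : pefield) (f : {rmorphism F -> L}) (FV : free_extension V f) :
  strong f <-> rotund V.
Proof.
have [domF _ _] := F_ELA; have [K [i [a0 [j]]]] := FV.
move=> [[[idom iexp _] domK _ a0P] [[domL _ _] [_ jexp _] j_strong _] fE].
have fexp x : pexp (f x) = f (pexp x).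
  by rewrite !fE /= jexp ?iexp //; [rewrite domF|apply: idom; rewrite domF].
have a0K k : dom K (a0 k) by rewrite domK; apply: Qspan_sub; right; exists k.
pose a := j \o a0.
(* The morphism j is injective and commutes with exp on [dom K], so genericity of the point passes
   from K to L. *)
have v_generic p : leval f (a, fun k => pexp (a k)) p = 0 <-> videal V p.
  rewrite -a0P; suff -> : leval f (a, fun k => pexp (a k)) p =
      j (leval i (a0, fun k => pexp (a0 k)) p).
    by split=> [/eqP|->]; rewrite ?rmorph0 // fmorph_eq0 => /eqP.
  rewrite /leval rmorph_mmap; apply: eq_mmap => [c|k] /=; first exact: fE.
  rewrite /lvals; case: (split k) => [l|l]; last first.
    by rewrite /a /= jexp // fmorphV.
  by case: (split l) => m //=; rewrite /a /= jexp.
split; first exact: (rotund_of_strong domF domL fexp v_generic V_addfree).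
(* For the converse, D is the image of [dom K] in L; [j_strong] says that delta over it is
   nonnegative. *)
have D_sub : Qsubspace (j @` dom K).
  have [K0 KD KZ] := dom_Qsubspace K; split.
  - by exists 0; [exact: K0|rewrite rmorph0].
  - move=> _ _ [x Kx <-] [y Ky <-]; exists (x + y); first exact: KD.
    by rewrite rmorphD.
  - move=> q _ [x Kx <-]; exists (ratr q * x); first exact: KZ.
    by rewrite rmorphM /= fmorph_rat.
apply: (strong_of_rotund domF domL fexp v_generic V_addfree D_sub).
- move=> _ [c _ <-]; exists (i c); first by apply: idom; rewrite domF.
  by rewrite fE.
- move=> _ [x Kx <-]; move: x Kx; rewrite domK.
  have [S0 SD SZ] := Qspan_subspace (range f `|` range a).
  apply: (@Qspan_min _ _ (j @^-1` Qspan (range f `|` range a))).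
    split=> [|x y Sx Sy|q x Sx] /=; first by rewrite rmorph0.
      by rewrite rmorphD; apply: SD.
    by rewrite rmorphM /= fmorph_rat; apply: SZ.
  move=> _ [[c _ <-]|[k _ <-]]; apply: Qspan_sub; last by right; exists k.
  by left; exists c => //; rewrite fE.
- move=> s; have := j_strong _ (tnth (in_tuple s)).
  rewrite delta_ge0 codom_tnth; apply.
  by move=> k; rewrite domL.
Qed.
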